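(* Let $I$ and $J$ be monomial ideals of $S$. Then: (i) $f\in I^*$ if and only if $\pi(f)\in I$, for all $f\in S^*$; (ii) $(I+J)^*=I^*+J^*$; (iii) $(IJ)^*=I^*J^*$; (iv) $(I\cap J)^*=I^*\cap J^*$; (v) $(I:J)^*=I^*:J^*$; (vi) $\sqrt{I^*}=(\sqrt{I})^*$; (vii) if the monomial ideal $Q\subseteq S$ is $P$-primary, then $Q^*$ is $P^*$-primary.
   Context: Let $K$ be a field and $S=K[x_1,\ldots,x_n]$. Fix an $n$-tuple $(i_1,\ldots,i_n)$ of positive integers, let $S^*$ be the polynomial ring over $K$ in the variables $x_{jk}$, $1\le j\le n$, $1\le k\le i_j$, and set $P_j=(x_{j1},\ldots,x_{ji_j})\subseteq S^*$. For a monomial ideal $I\subseteq S$ generated by monomials $\mathbf{x}^{\mathbf{a}_1},\ldots,\mathbf{x}^{\mathbf{a}_m}$, with $\mathbf{a}_i=(a_i(1),\ldots,a_i(n))$, the expansion of $I$ is the monomial ideal $$I^*=\sum_{i=1}^m P_1^{a_i(1)}\cdots P_n^{a_i(n)}\subseteq S^*,$$ which does not depend on the choice of monomial generators. The $K$-algebra homomorphism $\pi:S^*\to S$ is defined by $\pi(x_{jk})=x_j$ for all $j,k$.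
   Formalization: In (i), ''f in I* implies π(f) in I'' is proved for all f in S*, but the converse only for monomials f: for general f it is false, e.g. n=1, i_1=2, I=(x_1^2), f=x_11−x_12 has π(f)=0 in I while f is not in I*. *)

(* Defs.v *)
From mathcomp Require Import all_boot all_order all_algebra.
From mathcomp Require Import boolp classical_sets.
From mathcomp Require Import mpoly.

Set Implicit Arguments.
Unset Strict Implicit.
Unset Printing Implicit Defensive.

Import GRing.Theory.

Local Open Scope classical_set_scope.
Local Open Scope ring_scope.

Section Ideals.
Context {R : comNzRingType}.
Implicit Types (I J P Q G : set R).

(* The unit ideal is allowed, unlike in [ring_quotient.idealr_closed]. *)
Definition is_ideal I :=
  [/\ I 0, (forall f g, I f -> I g -> I (f + g)) & (forall a f, I f -> I (a * f))].

Definition ideal_gen G : set R := smallest is_ideal G.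

Definition idealD I J : set R := [set f + g | f in I & g in J].

Definition idealM I J : set R := ideal_gen [set f * g | f in I & g in J].

Definition idealX I k : set R := iter k (idealM I) [set: R].

Definition ideal_colon I J : set R := [set f | forall g, J g -> I (f * g)].

Definition radical I : set R := [set f | exists2 k, (0 < k)%N & I (f ^+ k)].

Definition is_primary Q :=
  [/\ is_ideal Q, ~ Q 1 & forall f g, Q (f * g) -> Q f \/ radical Q g].

Definition primary_to Q P := is_primary Q /\ radical Q = P.

Lemma ideal_gen_ideal G : is_ideal (ideal_gen G).
Proof.
split=> [A [[A0 _ _] _] //|f g If Ig A AG|a f If A AG].
  by have [[_ AD _] _] := AG; apply: AD; [apply: If | apply: Ig].
by have [[_ _ AM] _] := AG; apply: AM; apply: If.
Qed.

Lemma sub_ideal_gen G : G `<=` ideal_gen G.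
Proof. by move=> f Gf A [_]; apply. Qed.

Lemma ideal_gen_min G I : is_ideal I -> G `<=` I -> ideal_gen G `<=` I.
Proof. by move=> idI GI f; apply. Qed.

Lemma ideal_setT : is_ideal [set: R]. Proof. by []. Qed.

Lemma ideal_set0 : is_ideal ([set 0] : set R).
Proof.
split=> //= [f g -> ->|a f ->]; first by rewrite addr0.
by rewrite mulr0.
Qed.

Lemma idealD_ideal I J : is_ideal I -> is_ideal J -> is_ideal (idealD I J).
Proof.
move=> [I0 ID IM] [J0 JD JM]; split=> [|_ _ [f If [g Jg <-]] [f' If' [g' Jg' <-]]|].
- by exists 0 => //; exists 0; rewrite // addr0.
- by exists (f + f'); [exact: ID | exists (g + g'); [exact: JD | rewrite addrACA]].
- move=> a _ [f If [g Jg <-]].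
  by exists (a * f); [exact: IM | exists (a * g); [exact: JM | rewrite mulrDr]].
Qed.

Lemma idealM_ideal I J : is_ideal (idealM I J).
Proof. exact: ideal_gen_ideal. Qed.

Lemma idealX_ideal I k : is_ideal (idealX I k).
Proof. by case: k => [|k]; [exact: ideal_setT | exact: idealM_ideal]. Qed.

Lemma idealM_subset I I' J J' :
  I `<=` I' -> J `<=` J' -> idealM I J `<=` idealM I' J'.
Proof.
move=> sI sJ; apply: ideal_gen_min; first exact: idealM_ideal.
move=> _ [f If [g Jg <-]]; apply: sub_ideal_gen.
by exists f; [exact: sI | exists g; [exact: sJ|]].
Qed.

Lemma idealX_subset I k l : (k <= l)%N -> idealX I l `<=` idealX I k.
Proof.
move=> /subnK <-; elim: (l - k)%N => [//|d IHd]; rewrite addSn.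
apply: subset_trans IHd; apply: ideal_gen_min; first exact: idealX_ideal.
by move=> _ [f _ [g Ig <-]]; have [_ _] := idealX_ideal I (d + k); apply.
Qed.

End Ideals.

(* The variables x_{jk} of S^*, for j : 'I_n and k : 'I_(i j), are indexed
   by [tagnat.Rank j k]. *)
Notation Sstar K i := {mpoly K[\sum_j i j]}.

Section Expansion.
Context {K : fieldType} {n : nat}.

Definition mon_ideal (s : seq 'X_{1..n}) : set {mpoly K[n]} :=
  ideal_gen [set ('X_[m] : {mpoly K[n]}) | m in [set` s]].

Definition monomial_ideal (I : set {mpoly K[n]}) := exists s, I = mon_ideal s.

Context {i : 'I_n -> nat}.

Definition xvar (j : 'I_n) (k : 'I_(i j)) : Sstar K i := 'X_(tagnat.Rank j k).

Definition Pvar (j : 'I_n) : set (Sstar K i) := ideal_gen (range (@xvar j)).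

Definition expand_gens (s : seq 'X_{1..n}) : set (Sstar K i) :=
  \big[idealD/[set 0]]_(a <- s) \big[idealM/[set: Sstar K i]]_(j < n) idealX (Pvar j) (a j).

(* I^* is computed from an arbitrarily chosen finite family of monomial
   generators of I; [expansion_mon_ideal] below shows that the choice is
   irrelevant.  On ideals that are not monomial the value is junk. *)
Definition expansion (I : set {mpoly K[n]}) : set (Sstar K i) :=
  expand_gens (xget [::] [set s | I = mon_ideal s]).

Definition pi_expand (f : Sstar K i) : {mpoly K[n]} :=
  f \mPo [tuple ('X_(tagnat.sig1 v) : {mpoly K[n]}) | v < \sum_j i j].

Lemma mon_idealP s m : mon_ideal s 'X_[m] -> exists2 a, a \in s & (a <= m)%MM.
Proof.
pose A : set {mpoly K[n]} :=
  [set f | forall u, u \in msupp f -> exists2 a, a \in s & (a <= u)%MM].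
have idA : is_ideal A.
  split=> [u|f g Af Ag u /msuppD_le|a f Af u /msuppM_le].
  - by rewrite msupp0.
  - by rewrite mem_cat => /orP[/Af|/Ag].
  - case/allpairsP=> -[u1 u2] /= [_ /Af[b sb leb] ->].
    by exists b => //; apply: (lepm_trans leb); rewrite lem_addl.
have sA : mon_ideal s `<=` A.
  apply: ideal_gen_min => // _ [a /= sa <-] u.
  by rewrite msuppX mem_seq1 => /eqP->; exists a; rewrite ?lepm_refl.
by move=> /sA Am; apply: (Am m); rewrite msuppX mem_head.
Qed.

Let prodP (a : 'X_{1..n}) : set (Sstar K i) :=
  \big[idealM/[set: Sstar K i]]_(j < n) idealX (Pvar j) (a j).

Let prodP_subset a b : (a <= b)%MM -> prodP b `<=` prodP a.
Proof.
move=> /mnm_lepP leab; apply: (big_ind2 (fun A B => A `<=` B)) => //.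
  by move=> A A' B B' AA' BB'; apply: idealM_subset.
by move=> j _; apply: idealX_subset.
Qed.

Let prodP_ideal a : is_ideal (prodP a).
Proof.
apply: big_ind => [|A B _ _|j _]; first exact: ideal_setT.
  exact: idealM_ideal.
exact: idealX_ideal.
Qed.

Let expand_gens_ideal s : is_ideal (expand_gens s).
Proof.
apply: big_ind => [|A B|a _]; [exact: ideal_set0 | exact: idealD_ideal |].
exact: prodP_ideal.
Qed.

Let prodP_expand_gens s a : a \in s -> prodP a `<=` expand_gens s.
Proof.
rewrite /expand_gens; elim: s => [//|b s IHs]; rewrite inE big_cons => ab f af.
case/orP: ab => [/eqP <-|/IHs/(_ f af) sf].
  by exists f => //; exists 0; [have [] := expand_gens_ideal s | rewrite addr0].
by exists 0; [have [] := prodP_ideal b | exists f; rewrite ?add0r].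
Qed.

Lemma expand_gens_subset s t :
  mon_ideal s `<=` mon_ideal t -> expand_gens s `<=` expand_gens t.
Proof.
move=> st.
have {}st a : a \in s -> prodP a `<=` expand_gens t.
  move=> sa; have /st/mon_idealP[b tb ba] : mon_ideal s 'X_[a].
    by apply: sub_ideal_gen; exists a.
  exact/(subset_trans (prodP_subset ba))/prodP_expand_gens.
rewrite [X in X `<=` _]big_seq; have [t0 tD _] := expand_gens_ideal t.
apply: (big_ind (fun A => A `<=` expand_gens t)) => [f -> //|A B At Bt|a /st //].
by move=> _ [f /At ft [g /Bt gt <-]]; apply: tD.
Qed.

Lemma expansion_mon_ideal s : expansion (mon_ideal s) = expand_gens s.
Proof.
have e : mon_ideal s = mon_ideal (xget [::] [set t | mon_ideal s = mon_ideal t]).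
  by case: xgetP => [t _ //|/(_ s)/(_ erefl)].
by rewrite eqEsubset; split; apply: expand_gens_subset; rewrite -e.
Qed.

End Expansion.

Arguments expansion {K n} i I.

(* Main.v *)
(* A monomial ideal is the set [supported D] of the polynomials all of whose monomials lie
   in a set [D] of exponents that is closed under adding exponents; by Dickson's lemma
   every such [D] gives a monomial ideal.  The operations on ideals then become operations
   on exponent sets, and expansion becomes the preimage under [collapse], the effect of
   [pi_expand] on exponents.  This preimage commutes with all the operations, because a
   decomposition [collapse u = a + b] lifts to a decomposition of [u] and because
   [collapse] is surjective.  For primary ideals, leading monomials reduce the definition
   to monomials. *)
Require Import Defs.
From mathcomp Require Import all_boot all_order all_algebra.
From mathcomp Require Import boolp classical_sets.
From mathcomp Require Import mpoly.

Import GRing.Theory.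

Local Open Scope classical_set_scope.
Local Open Scope ring_scope.

(** * General ideals: sums, powers and radicals *)

Section IdealTheory.
Context {R : comNzRingType}.
Implicit Types (I : set R) (f g p : R).

Lemma ideal_sum I (T : Type) (r : seq T) (P : pred T) (F : T -> R) :
  is_ideal I -> (forall x, P x -> I (F x)) -> I (\sum_(x <- r | P x) F x).
Proof. by move=> [I0 ID _] IF; elim/big_ind: _. Qed.

Lemma idealMr I f g : is_ideal I -> I f -> I (f * g).
Proof. by move=> [_ _ IM] If; rewrite mulrC; apply: IM. Qed.

Lemma idealB I f g : is_ideal I -> I f -> I g -> I (f - g).
Proof. by move=> [_ ID IM] If Ig; apply: ID => //; rewrite -mulN1r; apply: IM. Qed.

Lemma ideal_expr_le I f k l : is_ideal I -> (k <= l)%N -> I (f ^+ k) -> I (f ^+ l).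
Proof. by move=> [_ _ IM] /subnK <- Ifk; rewrite exprD; apply: IM. Qed.

(** For sums, expand [(f + g) ^+ (k + l)] binomially: each term has at least [l] factors [g] or at
    least [k] factors [f]. *)
Lemma radical_ideal I : is_ideal I -> is_ideal (radical I).
Proof.
move=> idI; have [I0 ID IM] := idI; split.
- by exists 1%N; rewrite ?expr1.
- move=> f g [k k0 Ifk] [l l0 Igl]; exists (k + l)%N; first by rewrite addn_gt0 k0.
  rewrite exprDn; apply: ideal_sum => // x _; rewrite -mulr_natl; apply: (IM).
  have [lx|xl] := leqP l x; first by apply: IM; apply: ideal_expr_le Igl.
  apply: idealMr => //; apply: ideal_expr_le Ifk => //.
  by rewrite -addnBA ?leq_addr // ltnW.
- by move=> a f [k k0 Ifk]; exists k; rewrite // exprMn; apply: (IM).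
Qed.

(** The sum [p + g] divides [g ^+ k - (- p) ^+ k], so modulo [I] the products of [f] with these two
    powers agree. This removes from a factor its part [p] lying in the radical. *)
Lemma ideal_mul_expr_addr I f g p k : is_ideal I ->
  I (f * (p + g)) -> I (p ^+ k) -> I (f * g ^+ k).
Proof.
move=> idI Ifpg Ipk; have [_ ID IM] := idI.
rewrite -(subrK ((- p) ^+ k) (g ^+ k)) mulrDr; apply: ID; last first.
  by apply: (IM); rewrite exprNn; apply: IM.
by rewrite subrXX opprK (addrC g) mulrA; apply: idealMr.
Qed.

End IdealTheory.

(** * Ideals determined by exponent sets, and the operations on them *)

Section Supported.
Context {K : fieldType} {n : nat}.
Implicit Types (D E : set 'X_{1..n}) (u v w : 'X_{1..n}) (f g h : {mpoly K[n]}).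
Implicit Types (I : set {mpoly K[n]}).

Definition upper D := forall u v, D u -> D (u + v)%MM.

Definition supported D : set {mpoly K[n]} := [set f | forall u, u \in msupp f -> D u].

Definition sqrt_mnm D : set 'X_{1..n} := [set u | exists2 k, (0 < k)%N & D (u *+ k)%MM].

Lemma upper_le D u v : upper D -> (u <= v)%MM -> D u -> D v.
Proof. by move=> upD /submK <- Du; rewrite addmC; apply: upD. Qed.

Lemma supported_mpolyX D u : supported D 'X_[u] <-> D u.
Proof.
by split=> [|Du v]; [apply; rewrite msuppX mem_head | rewrite msuppX mem_seq1 => /eqP->].
Qed.

Lemma supported_inj D E : supported D = supported E -> D = E.
Proof. by move=> DE; apply/seteqP; split=> u; rewrite -!supported_mpolyX DE. Qed.

Lemma supportedD D f g : supported D f -> supported D g -> supported D (f + g).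
Proof. by move=> Df Dg u /msuppD_le; rewrite mem_cat => /orP[/Df|/Dg]. Qed.

Lemma supported0 D : supported D 0.
Proof. by move=> u; rewrite msupp0. Qed.

Lemma supported_ideal D : upper D -> is_ideal (supported D).
Proof.
move=> upD; split; [exact: supported0 | exact: supportedD |].
move=> a f Df u /msuppM_le/allpairsP[[v w] /= [_ /Df Dw ->]].
by rewrite addmC; apply: upD.
Qed.

(** A polynomial is a linear combination of its monomials. Inclusions of a supported ideal in
    another ideal are thereby checked on monomials only. *)
Lemma supported_sub D I :
  is_ideal I -> (forall u, D u -> I 'X_[u]) -> supported D `<=` I.
Proof.
move=> idI DI f Df; rewrite (mpolyE f) big_seq; apply: ideal_sum => // u uf.
by rewrite -mul_mpolyC; case: idI => _ _; apply; apply/DI/Df.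
Qed.

Lemma supported_split D f :
  exists g h, [/\ f = g + h, supported D g & supported (~` D) h].
Proof.
have term E : supported E (\sum_(u <- msupp f | `[< E u >]) f@_u *: 'X_[u]).
  elim/big_ind: _ => [||u /asboolP Eu v /msuppZ_le].
  - exact: supported0.
  - exact: supportedD.
  - by rewrite msuppX mem_seq1 => /eqP->.
exists (\sum_(u <- msupp f | `[< D u >]) f@_u *: 'X_[u]).
exists (\sum_(u <- msupp f | `[< (~` D) u >]) f@_u *: 'X_[u]).
split; rewrite // {1}(mpolyE f) (bigID (fun u => `[< D u >])) /=; congr (_ + _).
by apply: eq_bigl => u; rewrite asbool_neg.
Qed.

Lemma mon_idealE (s : seq 'X_{1..n}) :
  mon_ideal s = supported [set u | exists2 a, a \in s & (a <= u)%MM] :> set {mpoly K[n]}.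
Proof.
rewrite eqEsubset; split.
  apply: ideal_gen_min.
    by apply: supported_ideal => u v [a sa au]; exists a => //; apply/(lepm_trans au)/lem_addr.
  by move=> _ [a sa <-]; apply/supported_mpolyX; exists a => //; apply: lepm_refl.
apply: supported_sub => [|u [a sa /submK <-]]; first exact: ideal_gen_ideal.
rewrite mpolyXD; have [_ _] := @ideal_gen_ideal {mpoly K[n]} [set 'X_[m] | m in [set` s]].
by apply; apply: sub_ideal_gen; exists a.
Qed.

(* Dickson's lemma, by induction on the list of coordinates that are compared:
   beyond a bound [N] on the new coordinate the generators of the previous step
   suffice, and each value [c < N] of that coordinate is treated separately. *)
Lemma dickson_seq (r : seq 'I_n) D : exists s : seq 'X_{1..n},
  (forall a, a \in s -> D a) /\
  (forall u, D u -> exists2 a, a \in s & forall j, j \in r -> (a j <= u j)%N).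
Proof.
elim: r D => [|j r IHr] D.
  have [[a Da]|noD] := pselect (exists a, D a).
    exists [:: a]; split=> [b|u _]; first by rewrite mem_seq1 => /eqP->.
    by exists a; rewrite ?mem_head.
  by exists [::]; split=> // u Du; case: noD; exists u.
have [s0 [s0D s0P]] := IHr D.
have [s sP] := choice (fun c => IHr [set u | D u /\ u j = c]).
pose N := (\max_(a <- s0) a j)%N.
exists (s0 ++ flatten [seq s c | c <- iota 0 N]); split=> [a|u Du].
  rewrite mem_cat => /orP[/s0D //|/flatten_mapP[c _ sca]].
  by have [/(_ a sca)[]] := sP c.
have [Nu|uN] := leqP N (u j).
  have [a sa au] := s0P u Du; exists a; first by rewrite mem_cat sa.
  move=> k; rewrite inE => /orP[/eqP->|/au //].
  by apply: leq_trans Nu; rewrite /N (big_rem a) ?leq_maxl.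
have [sD /(_ u (conj Du erefl))[a sa au]] := sP (u j).
exists a.
  by rewrite mem_cat; apply/orP; right; apply/flatten_mapP; exists (u j); rewrite ?mem_iota.
by move=> k; rewrite inE => /orP[/eqP->|/au //]; have [_ ->] := sD a sa.
Qed.

(** Comparing all coordinates in [dickson_seq] gives finitely many generators. This matters because
    [expansion] is meaningful only on finitely generated monomial ideals. *)
Lemma monomial_ideal_supported D : upper D -> monomial_ideal (supported D).
Proof.
move=> upD; have [s [sD sP]] := dickson_seq (enum 'I_n) D.
exists s; rewrite mon_idealE; congr supported; apply/seteqP; split=> u.
  by case/sP=> a sa au; exists a => //; apply/mnm_lepP => j; apply: au; rewrite mem_enum.
by case=> a /sD Da /upper_le; apply.
Qed.

Lemma monomial_ideal_upper I : monomial_ideal I -> exists2 D, upper D & I = supported D.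
Proof.
move=> [s ->]; rewrite mon_idealE; eexists; last by [].
by move=> u v [a sa au]; exists a => //; apply/(lepm_trans au)/lem_addr.
Qed.

Lemma idealD_supported D E : upper D -> upper E ->
  idealD (supported D) (supported E) = supported (D `|` E).
Proof.
move=> upD upE; rewrite eqEsubset; split.
  move=> _ [f Df [g Eg <-]]; apply: supportedD => u; first by move/Df; left.
  by move/Eg; right.
apply: supported_sub; first by apply: idealD_ideal; apply: supported_ideal.
move=> u [Du|Eu]; [exists 'X_[u] | exists 0]; rewrite ?supported_mpolyX //.
- by exists 0; [exact: supported0 | rewrite addr0].
- exact: supported0.
- by exists 'X_[u]; rewrite ?supported_mpolyX ?add0r.
Qed.

Definition add_mnm_set D E : set 'X_{1..n} := [set (u + v)%MM | u in D & v in E].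

Lemma upper_add_mnm_set D E : upper D -> upper (add_mnm_set D E).
Proof.
move=> upD _ w [u Du [v Ev <-]]; exists (u + w)%MM; first exact: upD.
by exists v => //; rewrite -!addmA (addmC w).
Qed.

Lemma idealM_supported D E : upper D ->
  idealM (supported D) (supported E) = supported (add_mnm_set D E).
Proof.
move=> upD; rewrite eqEsubset; split.
  apply: ideal_gen_min; first exact/supported_ideal/upper_add_mnm_set.
  move=> _ [f Df [g Eg <-]] w /msuppM_le/allpairsP[[u v] /= [/Df Du /Eg Ev ->]].
  by exists u => //; exists v.
apply: supported_sub => [|_ [u Du [v Ev <-]]]; first exact: idealM_ideal.
rewrite mpolyXD; apply: sub_ideal_gen; exists 'X_[u]; first exact/supported_mpolyX.
by exists 'X_[v]; first exact/supported_mpolyX.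
Qed.

Lemma setI_supported D E : supported D `&` supported E = supported (D `&` E).
Proof.
rewrite eqEsubset; split=> f; first by move=> [Df Ef] u uf; split; [exact: Df|exact: Ef].
by move=> DEf; split=> u /DEf[].
Qed.

Definition colon_mnm_set D E : set 'X_{1..n} :=
  [set u | forall v, E v -> D (u + v)%MM].

Lemma upper_colon_mnm_set D E : upper D -> upper (colon_mnm_set D E).
Proof. by move=> upD u w Du v /Du; rewrite -addmA (addmC w) addmA; apply: upD. Qed.

Lemma colon_supported D E : upper D ->
  ideal_colon (supported D) (supported E) = supported (colon_mnm_set D E).
Proof.
move=> upD; rewrite eqEsubset; split=> f.
  move=> DEf u uf v Ev; have /DEf : supported E 'X_[v] by apply/supported_mpolyX.
  (* Multiplying by a monomial only translates the support, so no cancellation can remove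
     [u + v]. *)
  by apply; rewrite mcoeff_msupp addmC mcoeffMX -mcoeff_msupp.
by move=> DEf g Eg w /msuppM_le/allpairsP[[u v] /= [/DEf uf /Eg Ev ->]]; apply: uf.
Qed.

Lemma upper_sqrt_mnm D : upper D -> upper (sqrt_mnm D).
Proof.
move=> upD u v [k k0 Du]; exists k => //; apply: upper_le Du => //.
by apply/mnm_lepP => j; rewrite !mulmnE mnmDE leq_mul2r leq_addr orbT.
Qed.

(** Subtract from [f] its terms with exponents in [sqrt_mnm D]. The rest [h] is still in the
    radical; were it nonzero, the leading exponent of [h ^+ k], which is [k] times that of [h],
    would lie in [D], a contradiction. *)
Lemma radical_supported D : upper D -> radical (supported D) = supported (sqrt_mnm D).
Proof.
move=> upD; have idD := supported_ideal _ upD; have idR := radical_ideal _ idD.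
have sub : supported (sqrt_mnm D) `<=` radical (supported D).
  apply: supported_sub => // u [k k0 Du]; exists k => //.
  by rewrite mpolyXn; apply/supported_mpolyX.
rewrite eqEsubset; split=> // f fR.
have [g [h [fE Dg nDh]]] := supported_split (sqrt_mnm D) f.
suff h0 : h = 0 by rewrite fE h0 addr0.
apply/eqP/negP => /negP h0.
have : radical (supported D) h.
  by rewrite -(addKr g h) -fE addrC; apply: idealB => //; apply: sub.
case=> k k0 Dhk; apply: (nDh _ (mlead_supp h0)); exists k => //.
by rewrite -mleadX //; apply/Dhk/mlead_supp; rewrite expf_neq0.
Qed.

(* Strip from [f] the terms in [Q = supported D] and from [g] those in
   [radical Q]; if both remainders [f'], [g'] are nonzero then
   [f' * g' ^+ k] lies in [Q] for some [k], and its leading monomial contradicts the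
   hypothesis. *)
Lemma primary_supported D : upper D -> ~ D 0%MM ->
  (forall u v, D (u + v)%MM -> D u \/ sqrt_mnm D v) -> is_primary (supported D).
Proof.
move=> upD D0 Dprim; have idD := supported_ideal _ upD.
split=> // [|f g Dfg].
  by rewrite -mpolyX0 supported_mpolyX.
have [q [f' [fE Dq nDf']]] := supported_split D f.
have [p [g' [gE]]] := supported_split (sqrt_mnm D) g.
rewrite radical_supported // => Dp nDg'.
have [f'0|f'0] := eqVneq f' 0; first by left; rewrite fE f'0 addr0.
have [g'0|g'0] := eqVneq g' 0; first by right; rewrite gE g'0 addr0.
exfalso.
have [k k0 Dpk] : radical (supported D) p by rewrite radical_supported.
have Df'g : supported D (f' * (p + g')).
  by rewrite -gE -(addKr q f') -fE addrC mulrBl; exact: idealB idD Dfg (idealMr _ _ _ idD Dq).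
have Df'gk := ideal_mul_expr_addr _ _ _ _ _ idD Df'g Dpk.
have /Df'gk : mlead (f' * g' ^+ k) \in msupp (f' * g' ^+ k).
  by apply: mlead_supp; rewrite mulf_neq0 ?expf_neq0.
rewrite mleadM ?expf_neq0 // mleadX // => /Dprim[|[l l0 Dl]].
  exact/nDf'/mlead_supp.
apply: (nDg' _ (mlead_supp g'0)); exists (k * l)%N; first by rewrite muln_gt0 k0.
by rewrite (_ : (_ *+ _)%MM = (mlead g' *+ k *+ l)%MM) //;
  apply/mnmP => j; rewrite !mulmnE mulnA.
Qed.

Lemma primary_supported_mnm D u v : upper D -> is_primary (supported D) ->
  D (u + v)%MM -> D u \/ sqrt_mnm D v.
Proof.
move=> upD [_ _ /(_ 'X_[u] 'X_[v])]; rewrite -mpolyXD radical_supported //.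
by rewrite !supported_mpolyX.
Qed.

End Supported.

(** * The multidegree map on exponents and the lifting of decompositions *)

Section Collapse.
Context {K : fieldType} {n : nat} {i : 'I_n -> nat}.
Implicit Types (D E : set 'X_{1..n}) (a b : 'X_{1..n}) (u v w : 'X_{1..\sum_j i j}).

(** This is the multidegree for the grading in which every x_{jk} has degree [U_(j)];
    [tagnat.sig1 x] is the block [j] of the variable [x]. *)
Definition collapse u : 'X_{1..n} := [multinom (\sum_(x | tagnat.sig1 x == j) u x)%N | j < n].

Lemma collapseD u v : collapse (u + v)%MM = (collapse u + collapse v)%MM.
Proof.
apply/mnmP => j; rewrite mnmDE !mnmE -big_split.
by apply: eq_bigr => x _; rewrite mnmDE.
Qed.

Lemma collapse0 : collapse 0%MM = 0%MM.
Proof. by apply/mnmP => j; rewrite mnmE big1 ?mnm0E // => x _; rewrite mnm0E. Qed.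

Lemma collapseMn u k : collapse (u *+ k)%MM = (collapse u *+ k)%MM.
Proof. by elim: k => [|k IHk]; rewrite ?mulm0n ?collapse0 // !mulmS collapseD IHk. Qed.

Lemma collapse1 x : collapse U_(x)%MM = U_(tagnat.sig1 x)%MM.
Proof.
apply/mnmP => j; rewrite mnmE mnm1E; under eq_bigr do rewrite mnm1E.
have [<-|xj] := eqVneq (tagnat.sig1 x) j.
  by rewrite (bigD1 x) //= eqxx big1 // => y /andP[_]; rewrite eq_sym => /negbTE->.
by rewrite big1 // => y /eqP yj; case: eqVneq => // xy; rewrite xy yj eqxx in xj.
Qed.

Lemma collapseB u v : (v <= u)%MM -> collapse (u - v)%MM = (collapse u - collapse v)%MM.
Proof. by move/submK => {2}<-; rewrite collapseD addmK. Qed.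

Lemma collapse_gt0 u j :
  (0 < collapse u j)%N -> exists2 x, tagnat.sig1 x = j & (0 < u x)%N.
Proof.
rewrite mnmE => u0; apply/not_exists2P => no; move: u0.
rewrite big1 // => x /eqP xj; apply/eqP; rewrite -leqn0 leqNgt.
by apply/negP; case: (no x).
Qed.

(** Induction on the degree of [a]: lift [a - U_(j)] to some [v] below [u], then enlarge [v] by one
    variable of block [j] that [u] has not yet used up. *)
Lemma collapse_split u a :
  (a <= collapse u)%MM -> exists2 v, (v <= u)%MM & collapse v = a.
Proof.
have [d] := ubnP (mdeg a); elim: d a => // d IHd a ad au.
have [->|a0] := eqVneq a 0%MM.
  by exists 0%MM; [apply/mnm_lepP => x; rewrite mnm0E | exact: collapse0].
have [j aj] : exists j, (0 < a j)%N.
  apply/not_existsP => no; case/eqP: a0; apply/mnmP => j; rewrite mnm0E.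
  by apply/eqP; rewrite -leqn0 leqNgt; apply/negP/no.
have Uja : (U_(j) <= a)%MM.
  by apply/mnm_lepP => k; rewrite mnm1E; case: eqP => // <-.
have [|| v vu va] := IHd (a - U_(j))%MM.
- by move: ad; rewrite -{1}(submK Uja) mdegD mdeg1 addn1.
- exact: lepm_trans (lem_subr _ _) au.
(* Such a variable exists: [v] uses only [a j - 1] of block [j], while [u] offers at least [a j]. *)
have [|x xj] := collapse_gt0 (u - v)%MM j.
  rewrite collapseB // mnmBE va mnmBE mnm1E eqxx subn_gt0.
  by apply: leq_trans (mnm_lepP au j); rewrite ltn_subrL aj.
rewrite mnmBE subn_gt0 => vx; exists (v + U_(x))%MM.
  apply/mnm_lepP => y; rewrite mnmDE mnm1E; case: eqP => [<-|_]; first by rewrite addn1.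
  by rewrite addn0; apply/mnm_lepP.
by rewrite collapseD collapse1 xj va submK.
Qed.

Lemma collapse_add u a b : collapse u = (a + b)%MM ->
  exists v w, [/\ u = (v + w)%MM, collapse v = a & collapse w = b].
Proof.
move=> uab; have [|v vu va] := collapse_split u a; first by rewrite uab lem_addr.
exists v, (u - v)%MM; split=> //; first by rewrite addmC submK.
by rewrite collapseB // uab va addmC addmK.
Qed.

Lemma collapse_surj (i_gt0 : forall j, (0 < i j)%N) a : exists u, collapse u = a.
Proof.
(* Every variable of block [j] gets exponent [a j]. As blocks are nonempty this reaches at least
   [a], and [collapse_split] trims the excess. *)
pose u : 'X_{1..\sum_j i j} := [multinom a (tagnat.sig1 x) | x < \sum_j i j].
have [|v _ <-] := collapse_split u a; last by exists v.
apply/mnm_lepP => j; rewrite mnmE (bigD1 (tagnat.Rank j (Ordinal (i_gt0 j)))) /=.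
  by rewrite mnmE tagnat.Rank1K leq_addr.
by rewrite tagnat.Rank1K.
Qed.

Lemma pi_expand_mpolyX u : pi_expand ('X_[u] : Sstar K i) = 'X_[collapse u].
Proof.
rewrite /pi_expand comp_mpolyX.
rewrite (eq_bigr (fun x => 'X_[U_(tagnat.sig1 x)] ^+ u x)); last first.
  by move=> x _; rewrite tnth_mktuple.
rewrite mprodXnE; congr 'X_[_]; apply/mnmP => j.
rewrite mnm_sumE mnmE [RHS]big_mkcond; apply: eq_bigr => x _.
by rewrite mulmnE mnm1E; case: eqP; rewrite ?mul1n.
Qed.

(** * Preimages of exponent sets under [collapse] *)

Local Notation pullback D := (collapse @^-1` D).

Lemma upper_pullback D : upper D -> upper (pullback D).
Proof. by move=> upD u v Du; rewrite /preimage /= collapseD; apply: upD. Qed.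

Lemma upper_ge a : upper [set b | (a <= b)%MM].
Proof. by move=> b c ab; apply/(lepm_trans ab)/lem_addr. Qed.

Lemma add_pullback D E :
  add_mnm_set (pullback D) (pullback E) = pullback (add_mnm_set D E).
Proof.
apply/seteqP; split=> [_ [v Dv [w Ew <-]]|u [a Da [b Eb abu]]].
  by rewrite /preimage /= collapseD; exists (collapse v) => //; exists (collapse w).
have [v [w [-> va wb]]] := collapse_add _ _ _ (esym abu).
by exists v; [rewrite /preimage /= va | exists w; rewrite /preimage /= ?wb].
Qed.

Lemma sqrt_pullback D : sqrt_mnm (pullback D) = pullback (sqrt_mnm D).
Proof.
by apply/seteqP; split=> u [k k0 Du]; exists k; move: Du; rewrite // /preimage /= collapseMn.
Qed.

(** Surjectivity of [collapse] ensures that testing against exponents of the expanded ring tests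
    against every element of [E]. *)
Lemma colon_pullback (i_gt0 : forall j, (0 < i j)%N) D E :
  colon_mnm_set (pullback D) (pullback E) = pullback (colon_mnm_set D E).
Proof.
apply/seteqP; split=> u Du.
  by move=> a; have [v <-] := collapse_surj i_gt0 a => /Du; rewrite /preimage /= collapseD.
by move=> v /Du; rewrite /preimage /= collapseD.
Qed.

(** * Computation of the expansion as a preimage *)

Lemma Pvar_supported j :
  Pvar j = supported (pullback [set b | 0 < b j]%N) :> set (Sstar K i).
Proof.
rewrite eqEsubset; split.
  apply: ideal_gen_min.
    by apply: supported_ideal; apply: upper_pullback => a b /= a0; rewrite mnmDE addn_gt0 a0.
  move=> _ [k _ <-]; apply/supported_mpolyX.
  by rewrite /preimage /= collapse1 tagnat.Rank1K mnm1E eqxx.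
apply: supported_sub => [|u /collapse_gt0[x xj ux]]; first exact: ideal_gen_ideal.
have /submK <- : (U_(x) <= u)%MM.
  by apply/mnm_lepP => y; rewrite mnm1E; case: eqP => // <-.
rewrite mpolyXD; have [_ _] := @ideal_gen_ideal (Sstar K i) (range (@xvar K n i j)).
apply; apply: sub_ideal_gen; rewrite -xj; exists (tagnat.sig2 x) => //.
by rewrite /xvar tagnat.sig2K.
Qed.

(** Induction on [k]: an exponent with [j]-th entry at least [k + 1] is [U_(j)] plus one with entry
    at least [k], and products of ideals add exponent sets. *)
Lemma PvarX_supported j k :
  idealX (Pvar j) k = supported (pullback [set b | k <= b j]%N) :> set (Sstar K i).
Proof.
elim: k => [|k IHk]; first by apply/seteqP; split.
rewrite /idealX iterS -/(idealX _ k) IHk Pvar_supported idealM_supported; last first.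
  by apply: upper_pullback => a b /= a0; rewrite mnmDE addn_gt0 a0.
rewrite add_pullback; congr (supported (pullback _)); apply/seteqP; split.
  by move=> _ [a /= a0 [b /= kb <-]]; rewrite mnmDE -add1n leq_add.
move=> a /= ka; exists U_(j)%MM; first by rewrite /= mnm1E eqxx.
exists (a - U_(j))%MM;
  first by rewrite /= mnmBE mnm1E eqxx subn1 -ltnS prednK // (leq_trans _ ka).
by rewrite addmC submK //; apply/mnm_lepP => x; rewrite mnm1E;
  case: eqP => // <-; apply: leq_trans ka.
Qed.

Lemma prod_PvarX_supported a :
  \big[idealM/[set: Sstar K i]]_(j < n) idealX (Pvar j) (a j) =
  supported (pullback [set b | (a <= b)%MM]).
Proof.
(* Induction over duplicate-free lists of blocks: since [j] is not in the tail, splitting off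
   [U_(j) *+ a j] leaves the tail coordinates intact. *)
have step (r : seq 'I_n) : uniq r ->
    \big[idealM/[set: Sstar K i]]_(j <- r) idealX (Pvar j) (a j) =
    supported (pullback [set b | forall j, j \in r -> (a j <= b j)%N]).
  elim: r => [_|j r IHr /andP[jr /IHr {}IHr]]; first by rewrite big_nil; apply/seteqP; split.
  rewrite big_cons IHr PvarX_supported idealM_supported; last first.
    by apply: upper_pullback => b c /= ab; rewrite mnmDE (leq_trans ab) ?leq_addr.
  rewrite add_pullback; congr (supported (pullback _)); apply/seteqP; split.
    move=> _ [b /= ab [c /= ac <-]] k; rewrite inE mnmDE => /orP[/eqP->|/ac ack].
      by rewrite (leq_trans ab) ?leq_addr.
    by rewrite (leq_trans ack) ?leq_addl.
  move=> b ab; exists (U_(j) *+ a j)%MM; first by rewrite /= mulmnE mnm1E eqxx mul1n.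
  exists (b - U_(j) *+ a j)%MM => [k kr|].
    rewrite mnmBE mulmnE mnm1E; case: eqP kr jr => [->->//|_ kr _].
    by rewrite mul0n subn0 ab // inE kr orbT.
  rewrite addmC submK //; apply/mnm_lepP => k; rewrite mulmnE mnm1E.
  by case: eqP => // <-; rewrite mul1n ab // mem_head.
rewrite step ?index_enum_uniq //; congr (supported (pullback _)).
apply/seteqP; split=> b ab; last by move=> j _; apply/mnm_lepP.
by apply/mnm_lepP => j; apply: ab; rewrite mem_index_enum.
Qed.

Lemma expand_gens_supported (s : seq 'X_{1..n}) :
  expand_gens s =
  supported (pullback [set b | exists2 a, a \in s & (a <= b)%MM]) :> set (Sstar K i).
Proof.
rewrite /expand_gens; elim: s => [|a s IHs].
  rewrite big_nil eqEsubset; split=> [_ -> |]; first exact: supported0.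
  by apply: supported_sub => [|u []]; first exact: ideal_set0.
have ups : upper [set b | exists2 a, a \in s & (a <= b)%MM].
  by move=> b c [d sd db]; exists d => //; apply: upper_ge.
rewrite big_cons IHs prod_PvarX_supported idealD_supported; last 2 first.
- by apply: upper_pullback; apply: upper_ge.
- exact: upper_pullback.
congr supported; apply/seteqP; split=> u.
  by case=> [au|[b sb bu]]; [exists a; rewrite ?mem_head | exists b; rewrite // inE sb orbT].
by case=> b; rewrite inE => /orP[/eqP->|sb] bu; [left | right; exists b].
Qed.

(** Dickson's lemma provides generators [s], and [expansion_mon_ideal] allows computing with them.
    By [supported_inj], the exponents above some member of [s] are exactly [D]. *)
Lemma expansion_supported D :
  upper D -> expansion i (supported D : set {mpoly K[n]}) = supported (pullback D).
Proof.
move=> upD; have [s sE] := @monomial_ideal_supported K n D upD.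
rewrite sE expansion_mon_ideal expand_gens_supported; congr (supported (pullback _)).
by apply: (@supported_inj K); rewrite sE mon_idealE.
Qed.

Lemma pi_expand_supported D (f : Sstar K i) :
  upper D -> supported (pullback D) f -> supported D (pi_expand f).
Proof.
move=> upD Df; have idD := @supported_ideal K n D upD.
rewrite /pi_expand (mpolyE f) raddf_sum big_seq; apply: ideal_sum => // u /Df Du.
rewrite /= comp_mpolyZ -mul_mpolyC; case: idD => _ _; apply.
by rewrite -[X in supported _ X]/(pi_expand _) pi_expand_mpolyX; apply/supported_mpolyX.
Qed.

(** The criterion on exponents pulls back: [collapse] is additive, fixes zero, and its preimages
    commute with [sqrt_mnm]. *)
Lemma expansion_primary (i_gt0 : forall j, (0 < i j)%N) D :
  upper D -> is_primary (supported D : set {mpoly K[n]}) ->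
  is_primary (supported (pullback D) : set (Sstar K i)).
Proof.
move=> upD primD; apply: primary_supported => [||u v].
- exact: upper_pullback.
- by rewrite /preimage /= collapse0 => D0; case: primD => _ + _;
  apply; rewrite -mpolyX0 supported_mpolyX.
- rewrite sqrt_pullback /preimage /= collapseD; exact: primary_supported_mnm primD.
Qed.

End Collapse.

(** In (i) the equivalence is confined to monomials: [pi_expand] kills the difference of two
    distinct variables of one block, which is not in the expansion of the zero ideal. *)
Theorem lemma1p1 (K : fieldType) (n : nat) (i : 'I_n -> nat)
    (i_gt0 : forall j, (0 < i j)%N)
    (I J : set {mpoly K[n]}) (mI : monomial_ideal I) (mJ : monomial_ideal J) :
  ((forall f : Sstar K i, expansion i I f -> I (pi_expand f)) /\
   (forall m : 'X_{1..\sum_j i j},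
      expansion i I 'X_[m] <-> I (pi_expand ('X_[m] : Sstar K i)))) /\
  expansion i (idealD I J) = idealD (expansion i I) (expansion i J) /\
  expansion i (idealM I J) = idealM (expansion i I) (expansion i J) /\
  expansion i (I `&` J) = expansion i I `&` expansion i J /\
  expansion i (ideal_colon I J) = ideal_colon (expansion i I) (expansion i J) /\
  radical (expansion i I) = expansion i (radical I) /\
  (forall P Q : set {mpoly K[n]}, monomial_ideal Q -> primary_to Q P ->
     primary_to (expansion i Q) (expansion i P)).
Proof.
(* Stated for an arbitrary [D] because it serves both (vi) for [I] and the radical half of (vii) for
   [Q]. *)
have radE (D : set 'X_{1..n}) : upper D ->
    radical (supported (collapse @^-1` D) : set (Sstar K i)) =
    expansion i (radical (supported D : set {mpoly K[n]})).
  move=> upD; rewrite !radical_supported ?expansion_supported ?sqrt_pullback //.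
  - exact: upper_sqrt_mnm.
  - exact: upper_pullback.
have [D upD ->] := monomial_ideal_upper _ mI.
have [E upE ->] := monomial_ideal_upper _ mJ.
have upD' : upper (@collapse n i @^-1` D) by apply: upper_pullback.
have upE' : upper (@collapse n i @^-1` E) by apply: upper_pullback.
rewrite !expansion_supported //; split; [split|split; [|split; [|split; [|split; [|split]]]]].
- by move=> f; apply: pi_expand_supported.
- by move=> m; rewrite pi_expand_mpolyX !supported_mpolyX.
- rewrite !idealD_supported // expansion_supported //.
  by move=> a b [/upD|/upE] ab; [left | right].
- rewrite !idealM_supported // expansion_supported ?add_pullback //.
  exact: upper_add_mnm_set.
- rewrite !setI_supported expansion_supported //.
  by move=> a b [/upD Da /upE Ea]; split.
- rewrite !colon_supported // expansion_supported ?colon_pullback //.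
  exact: upper_colon_mnm_set.
- exact: radE.
- move=> P Q /monomial_ideal_upper[F upF ->] [primF <-].
  rewrite expansion_supported //; split; first exact: expansion_primary.
  exact: radE.
Qed.
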